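(* Let $\psi:\mathbb{S}_{++}^d\to\mathbb{R}$ be differentiable, isotonic and concave on $\mathbb{S}_{++}^d$, and let $\phi(M):=-\psi(M^{-1})$ for $M\succ 0$. Let $f$ be the associated objective function, and consider the iterates of the multiplicative algorithm with power parameter $\lambda$ applied to $\sup_{w\in\Delta_n} f(w)$. Assume that for some $k\ge 0$, the iterate $w^k$ satisfies $w^k\in\Delta_n^+$ and $\nabla_i f(w^k)>0$ for all $i\in\mathcal{I}_k$. Then for any $\lambda\in(0,1]$, we have $w^{k+1}\in\Delta_n^+$ and $f(w^{k+1})\ge f(w^k)$.
   Context: $\mathbb{S}^d$, $\mathbb{S}_+^d$, $\mathbb{S}_{++}^d$ denote the real symmetric $d\times d$ matrices, the positive semidefinite ones, and the positive definite ones; $A\succeq B$ (resp. $A\succ B$) means $A-B\in\mathbb{S}_+^d$ (resp. $A-B\in\mathbb{S}_{++}^d$). The inner product on $\mathbb{S}^d$ is $\langle A,B\rangle=\mathrm{tr}(AB)$, and gradients are taken with respect to it. A function $\psi:\mathbb{S}_{++}^d\to\mathbb{R}$ is isotonic if $0\prec A\preceq B$ implies $\psi(A)\le\psi(B)$. Data: $[n]=\{1,\dots,n\}$; $A_1,\dots,A_n\in\mathbb{S}_+^d$ with $A_i\neq 0$ for all $i\in[n]$ and $\sum_{i=1}^n A_i\succ 0$. For $w\in\mathbb{R}^n$, $M(w):=\sum_{i=1}^n w_iA_i$. $\Delta_n:=\{w\in\mathbb{R}^n: w\ge 0,\ \sum_i w_i=1\}$, $\mathrm{ri}\,\Delta_n:=\{w>0:\sum_i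 w_i=1\}$, $\Delta_n^+:=\{w\in\Delta_n: M(w)\succ 0\}$. Objective: given a differentiable $\phi:\mathbb{S}_{++}^d\to\mathbb{R}$, $f(w):=\phi(M(w))$ if $M(w)\succ 0$ and $f(w):=-\infty$ otherwise. At any $w$ with $M(w)\succ0$, $f$ is differentiable with partial derivatives $\nabla_i f(w)=\langle\nabla\phi(M(w)),A_i\rangle$. Multiplicative algorithm with power parameter $\lambda\in(0,1]$: start from $w^0\in\mathrm{ri}\,\Delta_n$; at iteration $k\ge 0$, set $\bar w^k_i:=w^k_i\,(\nabla_i f(w^k))^\lambda$ for $i\in[n]$ and $w^{k+1}:=\bar w^k/\sum_{i=1}^n\bar w^k_i$. $\mathcal{I}_k:=\{i\in[n]:w^k_i>0\}$ is the support of $w^k$. *)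

(* Defs.v *)
From HB Require Import structures.
From mathcomp Require Import all_boot all_order all_algebra sesquilinear.
From mathcomp Require Import all_classical all_reals all_analysis.

Set Implicit Arguments.
Unset Strict Implicit.
Unset Printing Implicit Defensive.

Import Order.TTheory GRing.Theory Num.Theory.
Import numFieldNormedType.Exports.

Local Open Scope classical_set_scope.
Local Open Scope ring_scope.

Lemma symmetricmxE (R : realType) (d : nat) (A : 'M[R]_d) :
  (A \is symmetricmx) = (A^T == A).
Proof. by rewrite is_hermitianmxE expr0 scale1r map_mx_id // eq_sym. Qed.

Fact symmetricmx_submod_closed (R : realType) (d : nat) :
  GRing.submod_closed (mem (symmetricmx : qualifier 0 'M[R]_d)).
Proof.
have memE (A : 'M[R]_d) :
    (A \in mem (symmetricmx : qualifier 0 'M[R]_d)) = (A^T == A).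
  exact: symmetricmxE.
split=> [|a A B]; rewrite !memE ?trmx0 //.
by move=> /eqP hA /eqP hB; rewrite linearP /= hA hB.
Qed.

(* The space S^d of real symmetric matrices is a normed space in its own right,
   so that differentiability of functions on S^d is the library's notion.  The
   norm is the restriction of the norm of 'M[R]_d; as S^d is finite-dimensional,
   its choice does not affect differentiability. *)
Record symmx (R : realType) (d : nat) := Symmx {
  symmx_val :> 'M[R]_d;
  symmxP : symmx_val \is symmetricmx }.

Section SymmxStructures.
Context {R : realType} {d : nat}.

HB.instance Definition _ := [isSub for @symmx_val R d].
HB.instance Definition _ := [Choice of symmx R d by <:].
HB.instance Definition _ :=
  GRing.SubChoice_isSubLmodule.Build R 'M[R]_d _ (symmx R d)
    (@symmetricmx_submod_closed R d).

Let norm (A : symmx R d) : R := `|val A|.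

Let ler_normD A B : norm (A + B) <= norm A + norm B.
Proof. by rewrite /norm raddfD ler_normD. Qed.

Let normrZ (l : R) A : norm (l *: A) = `|l| * norm A.
Proof. by rewrite /norm linearZ /= normrZ. Qed.

Let normr0_eq0 A : norm A = 0 -> A = 0.
Proof. by move=> /normr0_eq0 A0; apply/val_inj; rewrite A0 raddf0. Qed.

HB.instance Definition _ :=
  Lmodule_isNormed.Build R (symmx R d) ler_normD normrZ normr0_eq0.

End SymmxStructures.

Section Loewner.
Context {R : realType} {d : nat}.
Implicit Types A B : symmx R d.

Definition psdmx : set (symmx R d) :=
  [set A | forall v : 'rV[R]_d, 0 <= (v *m A *m v^T) ord0 ord0].

Definition pdmx : set (symmx R d) :=
  [set A | forall v : 'rV[R]_d, v != 0 -> 0 < (v *m A *m v^T) ord0 ord0].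

Fact symmx_inv_subproof A : invmx (A : 'M[R]_d) \is symmetricmx.
Proof. by rewrite symmetricmxE trmx_inv; have := symmxP A;
  rewrite symmetricmxE => /eqP ->. Qed.

Definition symmx_inv A : symmx R d := Symmx (symmx_inv_subproof A).

(* Functions on the open set S_{++}^d are represented by total functions on S^d
   of which only the values on pdmx are constrained. *)
Definition isotonic (psi : symmx R d -> R) :=
  forall A B, pdmx A -> psdmx (B - A) -> psi A <= psi B.

Definition concave_on_pd (psi : symmx R d -> R) :=
  convex_function pdmx (fun A => - psi A).

Definition differentiable_on_pd (psi : symmx R d -> R) :=
  forall A, pdmx A -> differentiable psi A.

End Loewner.

Section Design.
Context {R : realType} {d n : nat}.
Variable A : 'I_n -> symmx R d.
Implicit Types w : 'rV[R]_n.

Definition Mw w : symmx R d := \sum_i w ord0 i *: A i.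

Definition simplex : set 'rV[R]_n :=
  [set w | (forall i, 0 <= w ord0 i) /\ \sum_i w ord0 i = 1].

Definition ri_simplex : set 'rV[R]_n :=
  [set w | (forall i, 0 < w ord0 i) /\ \sum_i w ord0 i = 1].

Definition simplex_pd : set 'rV[R]_n := [set w | simplex w /\ pdmx (Mw w)].

Definition objective (phi : symmx R d -> R) w : \bar R :=
  if `[< pdmx (Mw w) >] then (phi (Mw w))%:E else -oo%E.

End Design.

Section MultiplicativeAlgorithm.
Context {R : realType} {n : nat}.
Variables (lambda : R) (f : 'rV[R]_n -> \bar R).
Implicit Types w : 'rV[R]_n.

(* Only meaningful where f is finite in a neighbourhood of w, which is the case
   for [objective A phi] wherever M(w) is positive definite. *)
Definition partial w (i : 'I_n) : R :=
  'D_('e_i : 'rV[R]_n) (fun v : 'rV[R]_n => fine (f v)) w.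

Definition mult_bar w : 'rV[R]_n :=
  \row_i (w ord0 i * partial w i `^ lambda).

(* If the entries of [mult_bar w] sum to 0, then the step is undefined and the
   convention x / 0 = 0 yields the null vector, which is outside the simplex and
   a fixed point of the step. *)
Definition mult_step w : 'rV[R]_n :=
  \row_i (mult_bar w ord0 i / \sum_j mult_bar w ord0 j).

Definition mult_iter (w0 : 'rV[R]_n) (k : nat) : 'rV[R]_n :=
  iter k mult_step w0.

Definition supp_w w : {set 'I_n} := [set i | 0 < w ord0 i].

End MultiplicativeAlgorithm.

(* Main.v *)
From HB Require Import structures.
Require Import Defs.
From mathcomp Require Import all_boot all_order all_algebra.
From mathcomp Require Import all_classical all_reals all_analysis.
From mathcomp Require Import ring lra.

Set Implicit Arguments.
Unset Strict Implicit.
Unset Printing Implicit Defensive.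

Import Order.TTheory GRing.Theory Num.Theory.
Import numFieldNormedType.Exports.

Local Open Scope classical_set_scope.
Local Open Scope ring_scope.

(** Write $M = M(w)$, $N = M^{-1}$, let $L$ be the differential of $\psi$ at
    $N$, and let $u$ be the next iterate.  The objective is $-\psi(M(w)^{-1})$,
    so the claim is $\psi(M(u)^{-1}) \le \psi(N)$.  The step does not increase a
    majorant of $u \mapsto \psi(M(u)^{-1})$ that is exact at $w$ (the choice
    $\lambda = 1/2$ minimizes it over the simplex):

    - $\psi$ lies below its tangent at $N$ by concavity ([concave_le_diff]), so
      it is enough that $L(M(u)^{-1}) \le L(N)$;
    - a matrix Cauchy-Schwarz inequality ([symmx_inv_Mw_le]) gives
      $M(u)^{-1} \preceq \sum_i (w_i^2/u_i) N A_i N$, with equality at $u = w$;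
    - $L$ is nonnegative on positive semidefinite matrices because $\psi$ is
      isotonic ([isotonic_diff_ge0]), so $L$ preserves that inequality.

    The formula $d(M^{-1}) = - N\,dM\,N$ identifies $g_i = L(N A_i N)$ with the
    partial derivative $\nabla_i f(w)$ where $w_i > 0$ ([partial_objective]), and
    $L(N) = L(N M N) = \sum_i w_i g_i$.  What is left is
    $\sum_i (w_i^2/u_i) g_i \le \sum_i w_i g_i$.  With
    $u_i = w_i g_i^\lambda / \sum_j w_j g_j^\lambda$ the left-hand side is
    $(\sum_i w_i g_i^{1-\lambda}) (\sum_j w_j g_j^\lambda)$, and the
    inequality is the sum inequality of Chebyshev ([chebyshev_sum]) for the
    sequences $g^{1-\lambda}$ and $g^\lambda$, which are similarly ordered since
    both exponents are nonnegative.

    The step keeps the support, which is why $M(u)$ stays positive definite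
    ([pdmx_Mw_supp]).  Outside the support $w_i = u_i = 0$, and the convention
    $0/0 = 0$ makes the corresponding terms vanish. *)

(** * Quadratic forms and the Loewner order *)

Section Loewner.
Context {R : realType} {d : nat}.
Implicit Types (X Y M : symmx R d) (P : 'M[R]_d) (v x y : 'rV[R]_d).

Definition bform X x y : R := (x *m X *m y^T) ord0 ord0.

Lemma bformDl X x y z : bform X (x + y) z = bform X x z + bform X y z.
Proof. by rewrite /bform !mulmxDl mxE. Qed.

Lemma bformZl X a x y : bform X (a *: x) y = a * bform X x y.
Proof. by rewrite /bform -!scalemxAl mxE. Qed.

Lemma bformC X x y : bform X x y = bform X y x.
Proof.
rewrite /bform -[LHS](mxE trmx_key (fun i j => _ j i)) -/(trmx _).
rewrite !trmx_mul trmxK mulmxA; congr ((_ *m _ *m _) _ _).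
by have := symmxP X; rewrite symmetricmxE => /eqP.
Qed.

Lemma bformBmx X Y x y : bform (X - Y) x y = bform X x y - bform Y x y.
Proof. by rewrite /bform [symmx_val _](raddfB val) mulmxBr mulmxBl !mxE. Qed.

Lemma bformZmx a X x y : bform (a *: X) x y = a * bform X x y.
Proof.
rewrite /bform -[symmx_val (a *: X)]/(a *: symmx_val X).
by rewrite -scalemxAr -scalemxAl mxE.
Qed.

(** A vector of the left kernel of $M$ annihilates its quadratic form. *)
Lemma pdmx_unit M : pdmx M -> (M : 'M[R]_d) \in unitmx.
Proof.
move=> Mpd; rewrite -row_free_unit -kermx_eq0; apply/rowV0P => v /sub_kermxP vM.
by apply/eqP/negP => /negP /Mpd; rewrite vM mul0mx mxE ltxx.
Qed.

Lemma pdmx_symmx_inv M : pdmx M -> pdmx (symmx_inv M).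
Proof.
move=> Mpd v v0; have Mu := pdmx_unit Mpd.
have -> : v *m symmx_inv M *m v^T = (v *m invmx M) *m M *m (v *m invmx M)^T.
  rewrite mulmxKV // trmx_mul trmx_inv.
  by have := symmxP M; rewrite symmetricmxE => /eqP ->; rewrite mulmxA.
apply: Mpd; apply: contraNneq v0 => /(congr1 (mulmx^~ M)).
by rewrite mulmxKV // mul0mx => ->.
Qed.

Fact symmx_congr_subproof P X : P *m X *m P^T \is symmetricmx.
Proof.
rewrite symmetricmxE !trmx_mul trmxK mulmxA.
by have := symmxP X; rewrite symmetricmxE => /eqP ->.
Qed.

(** Congruence by an arbitrary $P$ preserves symmetry, so that for $P = M^{-1}$
    the matrix $M^{-1} X M^{-1}$ is available as an element of the space of
    symmetric matrices. *)
Definition symmx_congr P X : symmx R d := Symmx (symmx_congr_subproof P X).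

Fact symmx_congr_is_linear P : linear (symmx_congr P).
Proof.
move=> a X Y; apply/val_inj.
have E : P *m (a *: (X : 'M[R]_d) + (Y : 'M[R]_d)) *m P^T
       = a *: (P *m X *m P^T) + P *m Y *m P^T.
  by rewrite mulmxDr mulmxDl -scalemxAr -scalemxAl.
exact: E.
Qed.

HB.instance Definition _ P :=
  GRing.isLinear.Build R (symmx R d) (symmx R d) _ (symmx_congr P)
    (symmx_congr_is_linear P).

Lemma bform_congr P X x y :
  bform (symmx_congr P X) x y = bform X (x *m P) (y *m P).
Proof. by rewrite /bform /= trmx_mul !mulmxA. Qed.

Lemma psdmx_congr P X : psdmx X -> psdmx (symmx_congr P X).
Proof. by move=> Xpsd v; rewrite -/(bform _ _ _) bform_congr; apply: Xpsd. Qed.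

Lemma symmx_inv_congr M : pdmx M -> symmx_congr (symmx_inv M) M = symmx_inv M.
Proof.
move=> /pdmx_unit Mu; apply/val_inj => /=; rewrite mulVmx // mul1mx.
by have := symmxP (symmx_inv M); rewrite symmetricmxE => /eqP.
Qed.

End Loewner.

(** * The matrices $M(w)$ *)

Section Information.
Context {R : realType} {d n : nat}.
Variable A : 'I_n -> symmx R d.
Hypothesis A_psd : forall i, psdmx (A i).
Implicit Types (w u : 'rV[R]_n) (x y : 'rV[R]_d).

Lemma bform_Mw w x y : bform (Mw A w) x y = \sum_i w ord0 i * bform (A i) x y.
Proof.
rewrite /bform /Mw [symmx_val _](raddf_sum val) mulmx_sumr mulmx_suml summxE.
apply: eq_bigr => i _.
exact: bformZmx.
Qed.

(** A vector that is null for $M(u)$ is null for every $A_i$ with $u_i > 0$,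
    hence for $M(w)$: only the support of the weights matters. *)
Lemma pdmx_Mw_supp w u :
  (forall i, 0 <= w ord0 i) -> (forall i, 0 <= u ord0 i) ->
  (forall i, u ord0 i = 0 -> w ord0 i = 0) -> pdmx (Mw A w) -> pdmx (Mw A u).
Proof.
move=> w0 u0 uw Mpd v v0; rewrite -/(bform _ _ _) bform_Mw.
have ge0 i : 0 <= u ord0 i * bform (A i) v v.
  by rewrite mulr_ge0 //; exact: A_psd.
rewrite lt_neqAle sumr_ge0 // andbT; apply/negP => /eqP/esym s0.
have := Mpd v v0; rewrite -/(bform _ _ _) bform_Mw big1 ?ltxx // => i _.
have /(_ i isT)/eqP := psumr_eq0P (fun i _ => ge0 i) s0.
by rewrite mulf_eq0 => /orP[/eqP/uw->|/eqP->]; rewrite ?mul0r ?mulr0.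
Qed.

(** A matrix Cauchy-Schwarz inequality: for $x = v N$ and $y = v M(u)^{-1}$, sum
    over $i$ the values of the forms $A_i$ at $w_i x - u_i y$, weighted by
    $1/u_i$.  The cross terms add up to $-2\, x M(w) y^T$, and both
    $x M(w) y^T$ and $y M(u) y^T$ equal $v M(u)^{-1} v^T$. *)
Lemma symmx_inv_Mw_le w u (N := symmx_inv (Mw A w)) :
  (forall i, 0 <= u ord0 i) -> (forall i, u ord0 i = 0 -> w ord0 i = 0) ->
  pdmx (Mw A w) -> pdmx (Mw A u) ->
  psdmx (symmx_congr N (Mw A (\row_i (w ord0 i ^+ 2 / u ord0 i)))
         - symmx_inv (Mw A u)).
Proof.
move=> u0 uw wpd upd v; rewrite -/(bform _ _ _) bformBmx bform_congr.
set x := v *m N; set U := Mw A u; set y := v *m symmx_inv U.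
have vy : v *m y^T = v *m symmx_inv U *m v^T.
  rewrite trmx_mul mulmxA.
  by have := symmxP (symmx_inv U); rewrite symmetricmxE => /eqP ->.
have Mxy : bform (Mw A w) x y = bform (symmx_inv U) v v.
  by rewrite /bform /x /= mulmxKV ?vy // pdmx_unit.
have Uyy : bform U y y = bform (symmx_inv U) v v.
  by rewrite {1}/bform {1}/y /= mulmxKV ?vy // pdmx_unit.
suff : 0 <= bform (Mw A (\row_i (w ord0 i ^+ 2 / u ord0 i))) x x
            - 2 * bform (Mw A w) x y + bform U y y.
  by rewrite Mxy Uyy; lra.
rewrite !bform_Mw mulr_sumr -sumrB -big_split sumr_ge0 //= => i _; rewrite mxE.
(* Here the convention 0^-1 = 0 turns w_i^2 / u_i into 0. *)
have [ui0|ui0] := eqVneq (u ord0 i) 0.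
  by rewrite ui0 (uw _ ui0) invr0 !(mulr0, mul0r) subr0 addr0.
have := A_psd i (w ord0 i *: x - u ord0 i *: y); rewrite -/(bform _ _ _).
have bE : bform (A i) (w ord0 i *: x - u ord0 i *: y)
                      (w ord0 i *: x - u ord0 i *: y)
  = w ord0 i ^+ 2 * bform (A i) x x
    - 2 * (w ord0 i * u ord0 i) * bform (A i) x y
    + u ord0 i ^+ 2 * bform (A i) y y.
  rewrite -scaleNr bformDl !bformZl ![bform _ _ (_ + _)]bformC !bformDl !bformZl.
  by rewrite (bformC _ y x); ring.
rewrite bE => sq_ge0.
rewrite -(@pmulr_rge0 _ (u ord0 i)) ?lt_def ?ui0 ?u0 //.
by apply: le_trans sq_ge0 _; rewrite le_eqVlt; apply/orP; left; apply/eqP; field.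
Qed.

End Information.

(** * Differentiating the inverse of a symmetric matrix *)

Section Derivatives.
Context {R : realType} {d : nat}.

Lemma cvg_mx T (F : set_system T) {FF : Filter F} m n (f : T -> 'M[R]_(m, n))
    (L : 'M[R]_(m, n)) :
  (forall i j, f t i j @[t --> F] --> L i j) -> f t @[t --> F] --> L.
Proof.
move=> fL; apply/cvg_ballP => e e0.
have H i j : \forall t \near F, ball (L i j) e (f t i j).
  by move/cvg_ballP : (fL i j); apply.
have := filter_forall FF (fun i => filter_forall FF (H i)).
by apply: filterS => t; split.
Qed.

Lemma cvg_mulmxl T (F : set_system T) {FF : Filter F} m n p
    (f : T -> 'M[R]_(m, n)) (L : 'M[R]_(m, n)) (B : 'M[R]_(n, p)) :
  f t @[t --> F] --> L -> f t *m B @[t --> F] --> L *m B.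
Proof.
move=> fL; apply: cvg_mx => i j; rewrite mxE.
under eq_fun do rewrite mxE.
apply: cvg_big => [|k _]; [exact: add_continuous|apply: cvgMl].
exact: (cvg_comp _ _ fL (@coord_continuous _ _ _ i k L)).
Qed.

(** The norm of symmetric matrices is the restriction of the matrix norm. *)
Lemma cvg_symmx T (F : set_system T) {FF : Filter F} (f : T -> symmx R d)
    (L : symmx R d) :
  (symmx_val (f t) @[t --> F] --> symmx_val L) -> f t @[t --> F] --> L.
Proof. by move=> /cvgrPdist_lt fL; apply/cvgrPdist_lt => e /fL. Qed.

(** Along a line, the determinant and the entries of the adjugate are
    polynomials in the parameter $h$, namely the determinant and adjugate of the
    matrix $P = M + T X$, with $T$ the polynomial variable, evaluated at $h$.
    Continuity of the inverse along the line reduces to that of polynomials. *)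
Section Line.
Variables M X : 'M[R]_d.
Let P : 'M[{poly R}]_d := map_mx polyC M + 'X *: map_mx polyC X.

Let map_P h : map_mx (horner_eval h) P = M + h *: X.
Proof. by apply/matrixP => i j; rewrite !mxE /= /horner_eval !hornerE. Qed.

Let det_P h : \det (M + h *: X) = (\det P).[h].
Proof. by rewrite -map_P det_map_mx. Qed.

Let adj_P h i j : \adj (M + h *: X) i j = (\adj P i j).[h].
Proof. by rewrite -map_P -map_mx_adj mxE. Qed.

Let P0 : M + 0 *: X = M. Proof. by rewrite scale0r addr0. Qed.

Lemma cvg_det_line : \det (M + h *: X) @[h --> (0 : R)] --> \det M.
Proof.
under eq_fun do rewrite det_P.
have := @continuous_horner R (\det P) 0.
by rewrite /continuous_at -det_P P0.
Qed.

Lemma near_unitmx_line : M \in unitmx ->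
  \forall h \near (0 : R), M + h *: X \in unitmx.
Proof.
rewrite unitmxE unitfE => detM.
apply: filterS (cvgr_neq0 (\det M) cvg_det_line detM) => h.
by rewrite unitmxE unitfE.
Qed.

Lemma cvg_invmx_line : M \in unitmx ->
  invmx (M + h *: X) @[h --> (0 : R)] --> invmx M.
Proof.
move=> Mu; have detM : \det M != 0 by rewrite -unitfE -unitmxE.
have E : \forall h \near (0 : R),
    (\det (M + h *: X))^-1 *: \adj (M + h *: X) = invmx (M + h *: X).
  apply: filterS (near_unitmx_line Mu) => h; rewrite /invmx => -> //.
apply: cvg_trans (near_eq_cvg E) _.
rewrite /invmx Mu; apply: cvg_mx => i j; rewrite mxE.
under eq_fun do rewrite mxE.
apply: cvgM; first exact: (cvgV detM cvg_det_line).
under eq_fun do rewrite adj_P.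
have := @continuous_horner R (\adj P i j) 0.
by rewrite /continuous_at -adj_P P0.
Qed.

End Line.

(** With $C_h = (M + h X)^{-1}$, the resolvent identity
    $C_h - M^{-1} = -h\, C_h X M^{-1}$ turns the difference quotient into
    $- C_h X M^{-1}$, and $C_h$ tends to $M^{-1}$. *)
Lemma is_derive_symmx_inv_line (M X : symmx R d) : (M : 'M[R]_d) \in unitmx ->
  is_derive (0 : R) 1 (fun h : R => symmx_inv (M + h *: X))
    (- symmx_congr (symmx_inv M) X).
Proof.
move=> Mu.
suff H : h^-1 *: (((fun h : R => symmx_inv (M + h *: X)) \o shift 0) (h *: 1)
             - symmx_inv (M + 0 *: X)) @[h --> (0 : R)^']
    --> - symmx_congr (symmx_inv M) X.
  by split; [exact: cvgP H | exact: cvg_lim H].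
apply: cvg_symmx.
have C : - (invmx (symmx_val M + h *: symmx_val X) *m X *m invmx M)
    @[h --> (0 : R)^'] --> - (invmx M *m X *m invmx M).
  apply: cvgN; apply: cvg_mulmxl; apply: cvg_mulmxl.
  by apply: cvg_within_filter; exact: (cvg_invmx_line X Mu).
have -> : symmx_val (- symmx_congr (symmx_inv M) X) 
    = - (invmx M *m X *m invmx M).
  rewrite -[LHS]/(- (invmx M *m X *m (invmx M)^T)).
  by have := symmxP (symmx_inv M); rewrite symmetricmxE => /eqP /= ->.
apply: cvg_trans C; apply: near_eq_cvg; near=> h.
have h0 : h != 0 by near: h; exact: nbhs_dnbhs_neq.
have hu : symmx_val M + h *: symmx_val X \in unitmx.
  by near: h; apply: nbhs_dnbhs; exact: near_unitmx_line.
rewrite -[RHS]/(h^-1 *: (invmx (symmx_val M + (h *: 1 + 0) *: symmx_val X)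
                   - invmx (symmx_val M + 0 *: symmx_val X))).
rewrite scale0r !addr0 -[h *: 1]/(h * 1) mulr1.
set C := invmx _.
have CE : C - invmx M = - (h *: (C *m X *m invmx M)).
  have -> : C - invmx M
      = C *m (symmx_val M - (symmx_val M + h *: symmx_val X)) *m invmx M.
    by rewrite mulmxBr mulmxBl mulmxK // mulVmx // mul1mx.
  rewrite opprD addrA subrr add0r.
  by rewrite mulmxN mulNmx -scalemxAr -scalemxAl.
by rewrite CE scalerN scalerA mulVf // scale1r.
Unshelve. all: by end_near. Qed.

(** * First-order consequences of monotonicity and concavity *)

Section Psi.
Variable psi : symmx R d -> R.

(** The difference quotients along $N + h X$ with $h > 0$ are nonnegative,
    because $N \preceq N + h X$. *)
Lemma isotonic_diff_ge0 (N X : symmx R d) : isotonic psi -> pdmx N ->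
  differentiable psi N -> psdmx X -> 0 <= 'd psi N X.
Proof.
move=> iso Npd dpsi Xpsd; rewrite -deriveE //.
have /cvg_dnbhs_at_right dX := @diff_derivable _ _ _ psi N X dpsi.
apply: (cvgr_to_ge dX); near=> h.
have h0 : 0 < h by [].
rewrite pmulr_rge0 ?invr_gt0 // subr_ge0; apply: iso => //=.
rewrite addrK => v; rewrite -/(bform _ _ _) bformZmx.
by apply: mulr_ge0 (ltW h0) _; exact: Xpsd.
Unshelve. all: by end_near. Qed.

(** Concavity bounds the difference quotients along $N + h (Y - N)$ with
    $0 < h \le 1$ from below by their value at $h = 1$. *)
Lemma concave_le_diff (N Y : symmx R d) : concave_on_pd psi -> pdmx N ->
  pdmx Y -> differentiable psi N -> psi Y <= psi N + 'd psi N (Y - N).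
Proof.
move=> conc Npd Ypd dpsi; rewrite -lerBlDl -deriveE //.
have /cvg_dnbhs_at_right dX := @diff_derivable _ _ _ psi N (Y - N) dpsi.
apply: (cvgr_to_ge dX); near=> h.
have h0 : 0 < h by [].
have h1 : h <= 1 by near: h; exact: nbhs_right_le.
rewrite -(ler_pM2l h0) mulVKf ?gt_eqF //=.
have := conc (Itv01 (ltW h0) h1) Y N; rewrite !inE => /(_ Ypd Npd).
rewrite convRE /=; set Z := conv _ _ _.
rewrite (_ : Z = h *: Y + (1 - h) *: N) //.
have -> : h *: Y + (1 - h) *: N = h *: (Y - N) + N.
  by rewrite scalerBl scale1r scalerBr addrCA addrC.
by rewrite /unstable.onem; lra.
Unshelve. all: by end_near. Qed.

End Psi.
End Derivatives.

(** * Partial derivatives of the objective *)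

Section Objective.
Context {R : realType} {d n : nat}.
Variables (A : 'I_n -> symmx R d) (psi : symmx R d -> R).
Hypothesis A_psd : forall i, psdmx (A i).

Lemma Mw_line (w : 'rV[R]_n) i h : Mw A (h *: 'e_i + w) = Mw A w + h *: A i.
Proof.
rewrite addrC /Mw (bigD1 i) //= [in RHS](bigD1 i) //= !mxE !eqxx mulr1.
rewrite scalerDl addrAC; congr (_ + _ + _); apply: eq_bigr => j ji.
by rewrite !mxE (negbTE ji) andbF mulr0 addr0.
Qed.

(** The chain rule at $M(w)$.  The condition $w_i > 0$ makes positive
    definiteness of $M(w + h e_i)$ for small $h$ of either sign a consequence of
    [pdmx_Mw_supp], so that near $w$ on this line the objective is the
    composition of $\psi$ with the inverse. *)
Lemma partial_objective (w : 'rV[R]_n) i (N := symmx_inv (Mw A w)) :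
  (forall j, 0 <= w ord0 j) -> 0 < w ord0 i -> pdmx (Mw A w) ->
  differentiable psi N ->
  partial (objective A (fun X => - psi (symmx_inv X))) w i
  = 'd psi N (symmx_congr N (A i)).
Proof.
move=> w0 wi0 wpd dpsi.
pose c (h : R) := symmx_inv (Mw A w + h *: A i).
have [dc Dc] := is_derive_symmx_inv_line (A i) (pdmx_unit wpd).
have c0 : c 0 = N by rewrite /c scale0r addr0.
have diffc : differentiable c 0 by apply/derivable1_diffP.
have dpsi' : differentiable psi (c 0) by rewrite c0.
have diffpc : differentiable (psi \o c) 0 by exact: differentiable_comp.
have D : 'D_1 (psi \o c) 0 = - 'd psi N (symmx_congr N (A i)).
  have dc1 : 'd c 0 (1 : R) = - symmx_congr N (A i) by rewrite -deriveE.
  by rewrite deriveE // diff_comp //= dc1 c0 linearN.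
rewrite -[RHS]opprK -D; apply: cvg_lim => //.
apply: cvg_trans (cvgN (@diff_derivable _ _ _ (psi \o c) 0 1 diffpc)).
apply: near_eq_cvg; near=> h.
have hw : `|h| < w ord0 i by near: h; exact: dnbhs0_lt.
have pdh : pdmx (Mw A (h *: 'e_i + w)).
  by apply: (pdmx_Mw_supp A_psd w0) wpd => j; rewrite !mxE eqxx /=;
    have [->|ji] := eqVneq j i; rewrite ?mulr0 ?add0r // mulr1;
    move: hw; rewrite ltr_norml; lra.
rewrite /= /objective !asboolT //= -opprD scalerN.
congr (- (_ *: (psi _ - psi _))); last by rewrite c0.
by rewrite addr0 Mw_line -[h *: 1]/(h * 1) mulr1.
Unshelve. all: by end_near. Qed.

End Objective.

(** * The sum inequality of Chebyshev *)

(** Twice the difference of the two sides is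
    $\sum_{i,j} w_i w_j (a_i - a_j)(b_i - b_j)$. *)
Lemma chebyshev_sum (R : realFieldType) (I : finType) (w a b : I -> R) :
  (forall i, 0 <= w i) -> (forall i j, 0 <= (a i - a j) * (b i - b j)) ->
  (\sum_i w i * a i) * (\sum_i w i * b i)
    <= (\sum_i w i) * (\sum_i w i * (a i * b i)).
Proof.
move=> w0 ab; rewrite -subr_ge0.
suff : 0 <= 2 * ((\sum_i w i) * (\sum_i w i * (a i * b i))
  - (\sum_i w i * a i) * (\sum_i w i * b i)) by rewrite pmulr_rge0.
have -> : 2 * ((\sum_i w i) * (\sum_i w i * (a i * b i))
    - (\sum_i w i * a i) * (\sum_i w i * b i))
  = \sum_i \sum_j w i * w j * ((a i - a j) * (b i - b j)).
  rewrite [RHS](eq_bigr (fun i => w i * (a i * b i) * (\sum_j w j)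
      + w i * (\sum_j w j * (a j * b j)) - w i * a i * (\sum_j w j * b j)
      - w i * b i * (\sum_j w j * a j))) => [|i _].
    by rewrite !sumrB big_split /= -!mulr_suml; ring.
  by rewrite !mulr_sumr -big_split -!sumrB; apply: eq_bigr => j _ /=; ring.
apply: sumr_ge0 => i _; apply: sumr_ge0 => j _.
by apply: mulr_ge0 (ab i j); exact: mulr_ge0.
Qed.

Lemma powR_comonotone (R : realType) (x y r s : R) : 0 <= x -> 0 <= y ->
  0 <= r -> 0 <= s -> 0 <= (x `^ r - y `^ r) * (x `^ s - y `^ s).
Proof.
move=> x0 y0 r0 s0; have [xy|/ltW yx] := leP x y.
  by apply: mulr_le0; rewrite subr_le0 ge0_ler_powR.
by apply: mulr_ge0; rewrite subr_ge0 ge0_ler_powR.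
Qed.

(** * Monotonicity of the step *)

(** A step depends on the current weights only, so ascent is a property of an
    arbitrary weight vector $x$, whatever iterates led to it. *)
Lemma mult_step_ascent (R : realType) (d n : nat) (A : 'I_n -> symmx R d)
    (psi : symmx R d -> R) (lambda : R) (x : 'rV[R]_n)
    (f := objective A (fun X => - psi (symmx_inv X))) :
  (forall i, psdmx (A i)) -> differentiable_on_pd psi -> isotonic psi ->
  concave_on_pd psi -> 0 <= lambda <= 1 -> simplex_pd A x ->
  (forall i, i \in supp_w x -> 0 < partial f x i) ->
  simplex_pd A (mult_step lambda f x)
  /\ (f x <= f (mult_step lambda f x))%E.
Proof.
move=> A_psd psi_diff psi_iso psi_concave lambda01 [[x_ge0 x_sum1] xpd] df_gt0.
set u := mult_step lambda f x; set N := symmx_inv (Mw A x).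
have dpsi := psi_diff _ (pdmx_symmx_inv xpd); rewrite -/N in dpsi.
pose L := 'd psi N; pose g i := L (symmx_congr N (A i)).
have partialE i : x ord0 i != 0 -> partial f x i = g i.
  by move=> xi; apply: partial_objective => //; rewrite lt_def xi x_ge0.
(* Off the support the hypothesis on partial derivatives says nothing; there the
   sign of g_i comes from monotonicity of psi.  Having it for all i lets the
   powers be compared for all pairs of indices. *)
have g_ge0 i : 0 <= g i.
  apply: isotonic_diff_ge0 => //; first exact: pdmx_symmx_inv.
  exact: psdmx_congr.
have g_gt0 i : x ord0 i != 0 -> 0 < g i.
  move=> xi; rewrite -partialE //; apply: df_gt0.
  by rewrite inE lt_def xi x_ge0.
pose S := \sum_j x ord0 j * g j `^ lambda.
have barE i : mult_bar lambda f x ord0 i = x ord0 i * g i `^ lambda.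
  rewrite mxE; have [->|xi] := eqVneq (x ord0 i) 0; first by rewrite !mul0r.
  by rewrite partialE.
have uE i : u ord0 i = x ord0 i * g i `^ lambda / S.
  by rewrite mxE barE; congr (_ / _); apply: eq_bigr.
have bar_eq0 i : x ord0 i * g i `^ lambda = 0 -> x ord0 i = 0.
  move=> /eqP; rewrite mulf_eq0 => /orP[/eqP //|g0].
  apply/eqP/negP => /negP /g_gt0 /(powR_gt0 lambda).
  by rewrite (eqP g0) ltxx.
have bar_ge0 i : 0 <= x ord0 i * g i `^ lambda.
  by rewrite mulr_ge0 // powR_ge0.
have S_gt0 : 0 < S.
  rewrite lt_def sumr_ge0 // andbT; apply/eqP.
  move=> /(psumr_eq0P (fun i _ => bar_ge0 i)) S0; move/eqP: x_sum1.
  by rewrite big1 ?(eq_sym 0) ?oner_eq0 // => i _; exact/bar_eq0/S0.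
have u_ge0 i : 0 <= u ord0 i by rewrite uE divr_ge0 // ltW.
have u_supp i : u ord0 i = 0 -> x ord0 i = 0.
  move=> /eqP; rewrite uE mulf_eq0 invr_eq0 (gt_eqF S_gt0) orbF.
  by move=> /eqP /bar_eq0.
have upd : pdmx (Mw A u) by exact: pdmx_Mw_supp xpd.
split.
  split=> //; split=> //; rewrite (eq_bigr _ (fun i _ => uE i)).
  by rewrite -mulr_suml divff ?gt_eqF.
rewrite /f /objective !asboolT // lee_fin lerN2.
(* The tangent bound reduces the claim to L (M(u)^-1) <= L N. *)
apply: le_trans (concave_le_diff psi_concave _ _ dpsi) _.
- exact: pdmx_symmx_inv.
- exact: pdmx_symmx_inv.
rewrite gerDl -/L linearB subr_le0 /=.
have L_Mw (c : 'rV[R]_n) : L (symmx_congr N (Mw A c)) = \sum_i c ord0 i * g i.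
  rewrite !linear_sum; apply: eq_bigr => i _.
  by rewrite !linearZ.
have LN : L N = \sum_i x ord0 i * g i.
  by rewrite -L_Mw symmx_inv_congr.
set B := \row_i (x ord0 i ^+ 2 / u ord0 i).
apply: (@le_trans _ _ (L (symmx_congr N (Mw A B)))).
  rewrite -subr_ge0 -linearB; apply: isotonic_diff_ge0 => //.
    exact: pdmx_symmx_inv.
  exact: symmx_inv_Mw_le.
have g_split i : g i `^ (1 - lambda) * g i `^ lambda = g i.
  by rewrite -powRD subrK ?oner_eq0 // powRr1.
rewrite LN L_Mw.
have -> : \sum_i B ord0 i * g i = (\sum_i x ord0 i * g i `^ (1 - lambda)) * S.
  rewrite mulr_suml; apply: eq_bigr => i _; rewrite mxE uE.
  have [->|xi] := eqVneq (x ord0 i) 0; first by rewrite expr0n !mul0r.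
  rewrite -{2}(g_split i).
  have gl_neq0 : g i `^ lambda != 0 by rewrite gt_eqF // powR_gt0 // g_gt0.
  by field; rewrite gl_neq0 xi gt_eqF.
have comonotone i j : 0 <= (g i `^ (1 - lambda) - g j `^ (1 - lambda))
                            * (g i `^ lambda - g j `^ lambda).
  by apply: powR_comonotone => //; case/andP: lambda01; lra.
have := chebyshev_sum x_ge0 comonotone.
by rewrite x_sum1 mul1r; under [X in _ <= X -> _]eq_bigr do rewrite g_split.
Qed.

Theorem theorem1 (R : realType) (d n : nat) (A : 'I_n -> symmx R d)
    (A_psd : forall i, psdmx (A i))
    (A_neq0 : forall i, A i != 0)
    (sumA_pd : pdmx (\sum_i A i))
    (psi : symmx R d -> R)
    (psi_diff : differentiable_on_pd psi)
    (psi_iso : isotonic psi)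
    (psi_concave : concave_on_pd psi)
    (lambda : R) (lambda01 : 0 < lambda <= 1)
    (w0 : 'rV[R]_n) (w0_ri : ri_simplex w0) (k : nat) :
  let phi := fun X : symmx R d => - psi (symmx_inv X) in
  let f := objective A phi in
  let w := mult_iter lambda f w0 in
  simplex_pd A (w k) ->
  (forall i, i \in supp_w (w k) -> 0 < partial f (w k) i) ->
  simplex_pd A (w k.+1) /\ (f (w k) <= f (w k.+1))%E.
Proof.
move=> phi f w wk_pd df_gt0; case/andP: lambda01 => /ltW lambda_ge0 lambda_le1.
by apply: mult_step_ascent; rewrite ?lambda_ge0.
Qed.
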